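(* Let $A\in\mathbb{R}^{n\times n}$ be passive, $B\in\mathbb{R}^{n\times q}$ and $C^*=c\in\mathbb{R}^n$ (so $p=1$). Let $s_2,\dots,s_k\in\mathbb{C}$ have positive real part, the list being closed under complex conjugation, and suppose that the rational Krylov subspace $$\mathcal{K}_k=\mathrm{span}\Big\{c,\ (A^*-s_2I)^{-1}c,\ \dots,\ \prod_{j=1}^{k-1}(A^*-s_{j+1}I)^{-1}c\Big\}$$ has dimension $k$. Let $V_k\in\mathbb{R}^{n\times k}$ have orthonormal columns spanning $\mathcal{K}_k$. Put $T_k=V_k^*AV_k$, $B_k=V_k^*B$, $C_k=c^*V_k$, let $Y_k\ge0$ be the stabilizing solution of $T_k^*Y+YT_k-YB_kB_k^*Y+C_k^*C_k=0$, let $X_k=V_kY_kV_k^*$, and let $\mathcal{T}_k=V_k^*(A-BB^*X_k)V_k=T_k-B_kB_k^*Y_k$. Define the rational function $$\psi_k(z)=\frac{\det(zI-T_k)}{\prod_{j=2}^k(z-s_j)}.$$ Assume that $\mathcal{T}_k$ is diagonalizable. Then the matrix $\widehat R_k=A^*V_kY_k+V_kY_k\mathcal{T}_k+cc^*V_k$ satisfies $$\widehat R_k=\psi_k(A^* )\,c\,c^*V_k\,(\psi_k(-\mathcal{T}_k))^{-1}.$$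
   Context: $M^*$ denotes the conjugate transpose. $Y\ge0$ means symmetric positive semidefinite. A matrix is stable if all its eigenvalues lie in the open left half complex plane; $A$ is passive if its field of values $\{x^*Ax/(x^*x): 0\ne x\in\mathbb{C}^n\}$ lies in the open left half plane. If $A$ is passive then $T_k$ is stable and the reduced Riccati equation has a unique positive semidefinite solution $Y_k$ that is stabilizing, i.e. such that $T_k-B_kB_k^*Y_k$ is stable. Rational functions are evaluated at matrices in the usual sense: with $\chi(z)=\det(zI-T_k)$ and $q(z)=\prod_{j=2}^k(z-s_j)$, $\psi_k(A^* )=\chi(A^* )q(A^* )^{-1}$, and $(\psi_k(-\mathcal{T}_k))^{-1}$ means $q(-\mathcal{T}_k)\,\chi(-\mathcal{T}_k)^{-1}$ (which is the inverse of $\psi_k(-\mathcal{T}_k)$ whenever the latter is defined). *)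

(* Defs.v *)
From HB Require Import structures.
From mathcomp Require Import all_boot all_order all_algebra.
From mathcomp Require Import complex.
From mathcomp Require Import reals.

Set Implicit Arguments.
Unset Strict Implicit.
Unset Printing Implicit Defensive.

Import Order.TTheory GRing.Theory Num.Theory.
Local Open Scope ring_scope.
Local Open Scope complex_scope.
Local Open Scope sesquilinear_scope.

(* The transpose [M^T] is used for M^* when M is real, and [M ^t*] when M is
   complex. *)

Definition cmx (R : realType) (m n : nat) (M : 'M[R]_(m, n)) : 'M[R[i]]_(m, n) :=
  map_mx (real_complex R) M.

Definition stable (R : realType) (n : nat) (M : 'M[R]_n) : Prop :=
  forall z : R[i], eigenvalue (cmx M) z -> complex.Re z < 0.

Definition field_of_values (R : realType) (n : nat) (A : 'M[R]_n) (z : R[i]) : Prop :=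
  exists2 x : 'cV[R[i]]_n, x != 0 &
    z = (x ^t* *m cmx A *m x) 0 0 / (x ^t* *m x) 0 0.

Definition passive (R : realType) (n : nat) (A : 'M[R]_n) : Prop :=
  forall z : R[i], field_of_values A z -> complex.Re z < 0.

Definition sympsd (R : realType) (n : nat) (Y : 'M[R]_n) : Prop :=
  Y^T = Y /\ forall x : 'cV[R]_n, 0 <= (x^T *m Y *m x) 0 0.

Definition stabilizing_solution (R : realType) (k q p : nat) (T : 'M[R]_k)
    (B : 'M[R]_(k, q)) (C : 'M[R]_(p, k)) (Y : 'M[R]_k) : Prop :=
  [/\ sympsd Y,
      T^T *m Y + Y *m T - Y *m B *m B^T *m Y + C^T *m C = 0
    & stable (T - B *m B^T *m Y)].

(* The list s of length k stands for the poles s_2, ..., s_(k+1).  The m-th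
   vector is (\prod_(j < m) (M - s_(j+2) I)^-1) c, and the rational Krylov
   space is spanned by those with m = 0, ..., k, so it is the space usually
   written K_(k+1). *)
Definition krylov_vec (R : realType) (n k : nat) (M : 'M[R[i]]_n.+1)
    (c : 'cV[R[i]]_n.+1) (s : k.-tuple R[i]) (m : nat) : 'cV[R[i]]_n.+1 :=
  (\prod_(z <- take m s) invmx (M - z%:M)) *m c.

Definition rational_krylov (R : realType) (n k : nat) (M : 'M[R[i]]_n.+1)
    (c : 'cV[R[i]]_n.+1) (s : k.-tuple R[i]) : {vspace 'cV[R[i]]_n.+1} :=
  <<[seq krylov_vec M c s m | m <- iota 0 k.+1]>>%VS.

Definition column_space (R : realType) (n k : nat) (V : 'M[R[i]]_(n, k)) :
    {vspace 'cV[R[i]]_n} :=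
  <<[seq col j V | j <- enum 'I_k]>>%VS.

(* A rational function is given as a pair (numerator, denominator), so its
   reciprocal is the swapped pair. *)
Definition ratfun (R : realType) : Type := ({poly R[i]} * {poly R[i]})%type.

Definition ratfun_inv (R : realType) (f : ratfun R) : ratfun R := (f.2, f.1).

(* As invmx M = M when M is singular, this is only meaningful when the
   denominator is invertible at M. *)
Definition ratfun_mx (R : realType) (n : nat) (f : ratfun R) (M : 'M[R[i]]_n.+1) :
    'M[R[i]]_n.+1 :=
  horner_mx M f.1 *m invmx (horner_mx M f.2).

Definition psi (R : realType) (k : nat) (T : 'M[R]_k.+1) (s : k.-tuple R[i]) :
    ratfun R :=
  (char_poly (cmx T), \prod_(z <- s) ('X - z%:P)).

(* Main.v *)
(* Write M = A^*, q(z) = \prod (z - s_j) and b = q(M)^-1 c.  Then K_k is the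
   polynomial Krylov space spanned by b, M b, ..., M^(k-1) b, so V_k^* f(M) b =
   f(T_k^* ) V_k^* b whenever deg f <= k, and the only vectors f(M) b with
   deg f <= k that are orthogonal to K_k are, by Cayley-Hamilton and a dimension
   count, the multiples of chi(M) b.  By the Riccati equation V_k^* Rhat = 0.
   If x is an eigenvector of -Tcal with eigenvalue lam, then V_k Y_k x = p(M) b
   with deg p < k, and Rhat x = f(M) b with f = (z - lam) p + (c^* V_k x) q; hence
   f = e chi for a scalar e, and evaluating at lam gives
   e chi(lam) = (c^* V_k x) q(lam).  Stability of T_k and of Tcal yields
   chi(lam) <> 0. *)
Require Import Defs.
From mathcomp Require Import all_boot all_order all_algebra.
From mathcomp Require Import complex.
From mathcomp Require Import reals.

Set Implicit Arguments.
Unset Strict Implicit.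
Unset Printing Implicit Defensive.

Import Order.TTheory GRing.Theory Num.Theory.
Local Open Scope ring_scope.
Local Open Scope complex_scope.

(** * Polynomial Krylov spaces *)

Definition krylov_mx (F : fieldType) (n : nat) (M : 'M[F]_n.+1)
    (b : 'cV[F]_n.+1) (d : nat) : 'M[F]_(n.+1, d) :=
  \matrix_(i < n.+1, j < d) (M ^+ j *m b) i 0.

Lemma krylov_mx_horner (F : fieldType) (n : nat) (M : 'M[F]_n.+1)
    (b : 'cV[F]_n.+1) (d : nat) (p : {poly F}) :
  (size p <= d)%N ->
  horner_mx M p *m b = krylov_mx M b d *m \col_j p`_j.
Proof.
move=> szp; have {1}-> : p = \sum_(i < d) p`_i *: 'X^i.
  rewrite -poly_def; apply/polyP => i; rewrite coef_poly.
  by case: ltnP => // ?; rewrite nth_default // (leq_trans szp).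
rewrite raddf_sum /= mulmx_suml; apply/colP => i; rewrite summxE !mxE.
apply: eq_bigr => j _; rewrite linearZ /= rmorphXn /= horner_mx_X.
by rewrite -scalemxAl !mxE mulrC.
Qed.

Definition in_poly_krylov (F : fieldType) (n : nat) (M : 'M[F]_n.+1)
    (b : 'cV[F]_n.+1) (d : nat) (v : 'cV[F]_n.+1) : Prop :=
  exists2 p : {poly F}, (size p <= d)%N & v = horner_mx M p *m b.

Lemma in_poly_krylovP (F : fieldType) (n : nat) (M : 'M[F]_n.+1)
    (b : 'cV[F]_n.+1) (d : nat) (v : 'cV[F]_n.+1) :
  in_poly_krylov M b d v <-> exists u : 'cV_d, v = krylov_mx M b d *m u.
Proof.
split=> [[p szp ->]|[u ->]].
  by exists (\col_j p`_j); exact: krylov_mx_horner.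
exists (rVpoly u^T); first exact: size_poly.
rewrite (krylov_mx_horner _ _ (size_poly _ _)); congr (_ *m _).
by apply/colP => j; rewrite !mxE coef_rVpoly_ord mxE.
Qed.

Lemma in_poly_krylov_span (F : fieldType) (n : nat) (M : 'M[F]_n.+1)
    (b : 'cV[F]_n.+1) (d : nat) (vs : seq 'cV[F]_n.+1) (v : 'cV[F]_n.+1) :
  (forall w, w \in vs -> in_poly_krylov M b d w) -> v \in <<vs>>%VS ->
  in_poly_krylov M b d v.
Proof.
move=> hvs /(@coord_span _ _ _ (in_tuple vs)) ->.
elim/big_ind: _ => [|x y|i _].
- by apply/in_poly_krylovP; exists 0; rewrite mulmx0.
- move=> /in_poly_krylovP[u ->] /in_poly_krylovP[w ->].
  by apply/in_poly_krylovP; exists (u + w); rewrite mulmxDr.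
have /in_poly_krylovP[u ->] : in_poly_krylov M b d (in_tuple vs)`_i.
  by apply: hvs; exact: mem_nth.
by apply/in_poly_krylovP; eexists; exact: scalemxAr.
Qed.

(** * Oblique projection onto a Krylov space of full dimension *)

Section Projection.
Variables (F : fieldType) (n k : nat) (M : 'M[F]_n.+1) (b : 'cV[F]_n.+1).
Variables (V : 'M[F]_(n.+1, k.+1)) (W : 'M[F]_(k.+1, n.+1)).
Hypothesis WV : W *m V = 1%:M.
Hypothesis colV : forall j, in_poly_krylov M b k.+1 (col j V).

Local Notation Kr := (krylov_mx M b k.+1).

(** The columns of [V] lie in the range of [Kr], so [V = Kr *m G] and [W *m Kr *m G = 1]. As [G] and
    [W *m Kr] are square, they are two-sided inverses of each other, and [V *m W] fixes [Kr]. *)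
Lemma krylov_mx_basis :
  [/\ W *m Kr \in unitmx, V *m (W *m Kr) = Kr & exists G, V = Kr *m G].
Proof.
have /fin_all_exists[g gE] : forall j, exists u, col j V = Kr *m u.
  by move=> j; have /in_poly_krylovP := colV j.
pose G := \matrix_(i, j) g j i 0.
have VE : V = Kr *m G.
  apply/matrixP => i j; have /colP/(_ i) := gE j; rewrite !mxE => ->.
  by apply: eq_bigr => l _; rewrite [G _ _]mxE.
have NG : W *m Kr *m G = 1%:M by rewrite -mulmxA -VE.
have [Nu _] := mulmx1_unit NG; split => //; last by exists G.
by rewrite {1}VE -mulmxA [G *m _](mulmx1C NG) mulmx1.
Qed.

Lemma krylov_proj (p : {poly F}) : (size p <= k.+1)%N ->
  V *m (W *m (horner_mx M p *m b)) = horner_mx M p *m b.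
Proof.
move=> szp; have [_ VN _] := krylov_mx_basis.
by rewrite (krylov_mx_horner _ _ szp) (mulmxA W) mulmxA VN.
Qed.

Lemma krylov_inj (p : {poly F}) : (size p <= k.+1)%N ->
  W *m (horner_mx M p *m b) = 0 -> p = 0.
Proof.
move=> szp; have [Nu _ _] := krylov_mx_basis.
rewrite (krylov_mx_horner _ _ szp) mulmxA => /(congr1 (mulmx (invmx (W *m Kr)))).
rewrite mulKmx // mulmx0 => /colP p0; apply/polyP => i; rewrite coef0.
have [ik|ki] := ltnP i k.+1; last by rewrite nth_default // (leq_trans szp).
by have := p0 (Ordinal ik); rewrite !mxE.
Qed.

Lemma krylov_surj (y : 'cV[F]_k.+1) : in_poly_krylov M b k.+1 (V *m y).
Proof.
have [_ _ [G ->]] := krylov_mx_basis; apply/in_poly_krylovP.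
by exists (G *m y); rewrite mulmxA.
Qed.

(** Induction on the degree: [V *m W] fixes [p(M) b] for [size p <= k.+1], so it can be inserted to
    the right of [M]. The last multiplication by [M] needs no projection, hence the bound [k.+2]
    instead of [k.+1]. *)
Lemma krylov_compress (p : {poly F}) : (size p <= k.+2)%N ->
  W *m (horner_mx M p *m b) = horner_mx (W *m M *m V) p *m (W *m b).
Proof.
set T := W *m M *m V.
elim/poly_ind: p => [|p a IH]; first by rewrite !rmorph0 !mul0mx mulmx0.
rewrite size_MXaddC; case: ifP => [/andP[/eqP -> /eqP ->] _|_].
  by rewrite mul0r addr0 !rmorph0 !mul0mx mulmx0.
rewrite ltnS => szp; rewrite !rmorphD !rmorphM /= !horner_mx_C !horner_mx_X.
rewrite !mulmxDl mulmxDr !mul_scalar_mx -scalemxAr; congr (_ + _).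
rewrite -!mulmxE -!(comm_mx_horner p (commr_refl _)).
by rewrite -!mulmxA -IH 1?ltnW // krylov_proj.
Qed.

(* W is a left inverse of V; its kernel plays the role of the orthogonal
   complement of the Krylov space. *)
Lemma krylov_orth_char_poly (p : {poly F}) : (size p <= k.+2)%N ->
  W *m (horner_mx M p *m b) = 0 -> p = p`_k.+1 *: char_poly (W *m M *m V).
Proof.
set chi := char_poly _ => szp Wp.
have szchi : size chi = k.+2 by exact: size_char_poly.
have lchi : chi`_k.+1 = 1.
  by have /monicP := char_poly_monic (W *m M *m V); rewrite lead_coefE szchi.
(* Since [chi] is monic of degree [k.+1], the difference has degree at most [k], where [W] is
   injective; [W] kills [chi(M) b] by compression and Cayley-Hamilton. *)
apply/eqP; rewrite -subr_eq0; apply/eqP; apply: krylov_inj.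
  apply/leq_sizeP => i; rewrite leq_eqVlt => /predU1P[<-|ki].
    by rewrite coefB coefZ lchi mulr1 subrr.
  have chii : chi`_i = 0 by rewrite nth_default ?szchi.
  by rewrite coefB coefZ chii mulr0 subr0 nth_default // (leq_trans szp).
rewrite rmorphB /= linearZ /= mulmxBl mulmxBr Wp -scalemxAl -scalemxAr.
by rewrite krylov_compress ?szchi // Cayley_Hamilton mul0mx scaler0 subrr.
Qed.

(** Keeping [chi.[lam]] on the left avoids any division; the factor is cancelled later, through the
    invertibility of [chi] at the matrix. *)
Lemma krylov_residual (q : {poly F}) (y : 'cV[F]_k.+1) (lam a : F)
    (r := M *m (V *m y) - lam *: (V *m y) + a *: (horner_mx M q *m b))
    (chi := char_poly (W *m M *m V)) :
  (size q <= k.+2)%N -> W *m r = 0 ->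
  chi.[lam] *: r = (a * q.[lam]) *: (horner_mx M chi *m b).
Proof.
move=> szq; have [p szp yE] := krylov_surj y.
pose phi := p * ('X - lam%:P) + a *: q.
have rE : r = horner_mx M phi *m b.
  rewrite /r yE /phi rmorphD rmorphM rmorphB /=
    horner_mx_X horner_mx_C horner_mxZ.
  rewrite mulmxDl -!scalemxAl; congr (_ + _).
  rewrite -mulmxE mulmxBr mulmxBl -(comm_mx_horner p (commr_refl _)) mulmxA.
  by rewrite mul_mx_scalar scalemxAl.
have szphi : (size phi <= k.+2)%N.
  rewrite (leq_trans (size_polyD _ _)) // geq_max; apply/andP; split.
    by rewrite (leq_trans (size_polyMleq _ _)) // size_XsubC addn2.
  by rewrite (leq_trans (size_scale_leq _ _)).
rewrite rE => /(krylov_orth_char_poly szphi); rewrite -/chi.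
(* At [lam] the term [p * ('X - lam%:P)] vanishes, which leaves [a * q.[lam] = e * chi.[lam]]. *)
move: phi`_k.+1 => e phiE; have := congr1 (horner^~ lam) phiE.
rewrite hornerD hornerM hornerXsubC subrr mulr0 add0r !hornerZ => ->.
by rewrite phiE horner_mxZ -scalemxAl scalerA mulrC.
Qed.

End Projection.

(** * Eigenvectors and polynomials in a matrix *)

Lemma char_poly_trmx (F : comNzRingType) (n : nat) (A : 'M[F]_n) :
  char_poly A^T = char_poly A.
Proof.
rewrite /char_poly -[RHS]det_tr; congr (\det _).
by apply/matrixP => i j; rewrite !mxE eq_sym.
Qed.

Lemma horner_mx_eigenvector (F : fieldType) (n : nat) (S : 'M[F]_n.+1)
    (x : 'cV[F]_n.+1) (lam : F) (p : {poly F}) :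
  S *m x = lam *: x -> horner_mx S p *m x = p.[lam] *: x.
Proof.
move=> Sx; elim/poly_ind: p => [|p a IH].
  by rewrite rmorph0 mul0mx horner0 scale0r.
rewrite rmorphD rmorphM /= horner_mx_X horner_mx_C mulmxDl -mulmxE -mulmxA Sx.
by rewrite -scalemxAr IH mul_scalar_mx hornerMXaddC scalerDl scalerA mulrC.
Qed.

(** With [P] diagonalizing [S] by rows, the columns of [invmx P] are a basis of right
    eigenvectors. *)
Lemma diagonalizable_mx_ext (F : fieldType) (m n : nat) (S : 'M[F]_n.+1)
    (G H : 'M[F]_(m, n.+1)) :
  diagonalizable S ->
  (forall (x : 'cV_n.+1) lam, S *m x = lam *: x -> G *m x = H *m x) -> G = H.
Proof.
move=> [P Pu /(diagonalizable_forLR Pu)[D SE]] GH.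
have SP : S *m invmx P = invmx P *m diag_mx D.
  by rewrite SE mxpoly.conjumx ?unitmx_inv // invmxK mulmxK.
have Pvu : invmx P \in unitmx by rewrite unitmx_inv.
rewrite -[G](mulmxK Pvu) -[H](mulmxK Pvu); congr (_ *m _).
apply/matrixP => i j; have := GH (col j (invmx P)) (D 0 j).
rewrite !colE !mulmxA SP -!colE => /(_ _)/colP/(_ i); rewrite !mxE; apply.
by apply/colP => l; rewrite mul_mx_diag !mxE mulrC.
Qed.

Lemma not_eigenvalue_unit (F : fieldType) (n : nat) (S : 'M[F]_n.+1) (z : F) :
  ~~ eigenvalue S z -> S - z%:M \in unitmx.
Proof. by rewrite negbK kermx_eq0 row_free_unit. Qed.

Lemma horner_mx_prod_XsubC_unit (F : fieldType) (n : nat) (S : 'M[F]_n.+1)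
    (s : seq F) :
  (forall z, z \in s -> ~~ eigenvalue S z) ->
  horner_mx S (\prod_(z <- s) ('X - z%:P)) \in unitmx.
Proof.
move=> sS; rewrite rmorph_prod /= big_seq; elim/big_rec: _ => [|z p zs pu].
  exact: unitmx1.
rewrite -mulmxE unitmx_mul pu andbT rmorphB /= horner_mx_X horner_mx_C.
exact/not_eigenvalue_unit/sS.
Qed.

Lemma horner_mx_unit (F : closedFieldType) (n : nat) (S : 'M[F]_n.+1)
    (p : {poly F}) :
  p != 0 -> (forall z, root p z -> ~~ eigenvalue S z) ->
  horner_mx S p \in unitmx.
Proof.
move=> p0; have [r pE] := closed_field_poly_normal p => pS.
rewrite pE horner_mxZ unitmxZ ?unitfE ?lead_coef_eq0 //.
apply: horner_mx_prod_XsubC_unit => z zr; apply: pS.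
by rewrite pE rootZ ?lead_coef_eq0 // root_prod_XsubC.
Qed.

(** * Passivity and stability *)

Section Passive.
Local Open Scope sesquilinear_scope.

Lemma passive_Re_lt0 (R : realType) (n : nat) (A : 'M[R]_n)
    (x : 'cV[R[i]]_n) (z : R[i]) :
  passive A -> x != 0 -> x ^t* *m cmx A *m x = z *: (x ^t* *m x) ->
  complex.Re z < 0.
Proof.
move=> pA x0 xAx; apply: pA; exists x => //.
rewrite xAx mxE mulfK //.
have -> : (x ^t* *m x) 0 0 = \sum_i `|x i 0| ^+ 2.
  by rewrite mxE; apply: eq_bigr => i _; rewrite !mxE normCK mulrC.
apply: contraNneq x0 => /eqP; rewrite psumr_eq0; last by move=> *; exact: exprn_ge0.
move=> /allP x0; apply/eqP/colP => i; have := x0 i (mem_index_enum _).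
by rewrite mxE sqrf_eq0 normr_eq0 => /eqP.
Qed.

Lemma cmxM (R : realType) (m n p : nat) (M : 'M[R]_(m, n)) (N : 'M[R]_(n, p)) :
  cmx (M *m N) = cmx M *m cmx N.
Proof. exact: map_mxM. Qed.

Lemma cmxD (R : realType) (m n : nat) (M N : 'M[R]_(m, n)) :
  cmx (M + N) = cmx M + cmx N.
Proof. exact: map_mxD. Qed.

Lemma cmx_adj (R : realType) (m n : nat) (M : 'M[R]_(m, n)) :
  (cmx M) ^t* = cmx M^T.
Proof.
by apply/matrixP => i j; rewrite !mxE; apply/eqP; rewrite eq_complex /= oppr0 !eqxx.
Qed.

Lemma passive_compression_stable (R : realType) (n k : nat) (A : 'M[R]_n)
    (V : 'M[R]_(n, k)) :
  passive A -> V^T *m V = 1%:M -> stable (V^T *m A *m V).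
Proof.
move=> pA VV z /eigenvalueP[v vT v0].
have WV : cmx V^T *m cmx V = 1%:M by rewrite -cmxM VV [LHS]map_mx1.
(* [eigenvalue] provides a row vector [v], so the test vector is built from its adjoint; then
   [x^* A x = z v v^*] and [x^* x = v v^*]. *)
pose x := cmx V *m v ^t*.
have xE : x ^t* = v *m cmx V^T by rewrite trmx_mul map_mxM /= trmxCK cmx_adj.
apply: (passive_Re_lt0 (x := x) pA).
  apply: contraNneq v0 => /(congr1 (fun y => cmx V^T *m y)).
  rewrite mulmxA WV mul1mx mulmx0 => /(congr1 (fun y => y ^t*)).
  by rewrite trmxCK trmx0 map_mx0 => ->.
rewrite xE /x !mulmxA -[v *m _ *m cmx V]mulmxA WV mulmx1 scalemxAl -vT.
by rewrite !cmxM !mulmxA.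
Qed.

(** A left eigenvector of [A^T] transposes to a right eigenvector of [A] for the same [z], so [z]
    lies in the field of values of [A]. *)
Lemma passive_stable_trmx (R : realType) (n : nat) (A : 'M[R]_n) :
  passive A -> stable A^T.
Proof.
move=> pA z /eigenvalueP[v vA v0]; apply: (passive_Re_lt0 (x := v^T) pA).
  by rewrite -trmx0 (inj_eq trmx_inj).
rewrite -mulmxA scalemxAr; congr (_ *m _).
by apply: trmx_inj; rewrite trmx_mul trmxK map_trmx vA linearZ /= trmxK.
Qed.

End Passive.

(** * From rational to polynomial Krylov spaces *)

Lemma prod_invmx_mul_horner (F : fieldType) (n : nat) (M : 'M[F]_n.+1) (s : seq F) :
  (forall z, z \in s -> M - z%:M \in unitmx) ->
  (\prod_(z <- s) invmx (M - z%:M)) *m horner_mx M (\prod_(z <- s) ('X - z%:P))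
    = 1%:M.
Proof.
elim: s => [|a s IH] sM; first by rewrite !big_nil rmorph1 mul1mx.
rewrite !big_cons [_ * \prod_(_ <- _) ('X - _)]mulrC rmorphM rmorphB /=.
rewrite horner_mx_X horner_mx_C -!mulmxE -mulmxA (mulmxA (\prod_(_ <- _) _)).
rewrite IH => [|z zs]; last by rewrite sM // inE zs orbT.
by rewrite mul1mx mulVmx // sM // mem_head.
Qed.

(** Writing [c = q(M) b], the inverses for the first [m] poles cancel against factors of [q]; the
    remaining poles give a polynomial of degree at most [k]. *)
Lemma krylov_vec_in_poly (R : realType) (n k : nat) (M : 'M[R[i]]_n.+1)
    (c : 'cV[R[i]]_n.+1) (s : k.-tuple R[i])
    (q := \prod_(z <- s) ('X - z%:P)) (m : nat) :
  (forall z, z \in s -> M - z%:M \in unitmx) ->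
  in_poly_krylov M (invmx (horner_mx M q) *m c) k.+1 (krylov_vec M c s m).
Proof.
move=> sM; exists (\prod_(z <- drop m s) ('X - z%:P)).
  by rewrite size_prod_XsubC ltnS size_drop size_tuple leq_subr.
have qu : horner_mx M q \in unitmx.
  by have := prod_invmx_mul_horner sM => /mulmx1_unit[].
have tM z : z \in take m s -> M - z%:M \in unitmx by move/mem_take/sM.
rewrite /krylov_vec -[c in LHS](mulKVmx qu) !mulmxA; congr (_ *m _ *m _).
have -> : q = \prod_(z <- take m s) ('X - z%:P) * \prod_(z <- drop m s) ('X - z%:P).
  by rewrite -big_cat cat_take_drop.
by rewrite rmorphM /= -mulmxE mulmxA prod_invmx_mul_horner // mul1mx.
Qed.

Lemma diagonalizable_oppmx (F : fieldType) (n : nat) (A : 'M[F]_n) :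
  diagonalizable A -> diagonalizable (- A).
Proof.
move=> [P Pu /(diagonalizable_forP _ Pu) dA]; exists P => //.
by apply/(diagonalizable_forP _ Pu) => i j ij; rewrite mulmxN mulNmx mxE dA ?oppr0.
Qed.

Theorem theorem5p4 (R : realType) (n k q : nat)
    (A : 'M[R]_n.+1) (B : 'M[R]_(n.+1, q)) (c : 'cV[R]_n.+1)
    (s : k.-tuple R[i]) (V : 'M[R]_(n.+1, k.+1)) (Y : 'M[R]_k.+1) :
  let Kry := rational_krylov (cmx A^T) (cmx c) s in
  let T := V^T *m A *m V in
  let Bk := V^T *m B in
  let Ck := c^T *m V in
  let X := V *m Y *m V^T in
  let Tcal := V^T *m (A - B *m B^T *m X) *m V in
  let Rhat := A^T *m V *m Y + V *m Y *m Tcal + c *m c^T *m V in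
  passive A ->
  (forall z : R[i], z \in s -> 0 < complex.Re z) ->
  perm_eq [seq z^* | z <- s] s ->
  \dim Kry = k.+1 ->
  V^T *m V = 1%:M ->
  column_space (cmx V) = Kry ->
  stabilizing_solution T Bk Ck Y ->
  diagonalizable (cmx Tcal) ->
  cmx Rhat =
    ratfun_mx (psi T s) (cmx A^T) *m cmx c *m cmx (c^T *m V)
      *m ratfun_mx (ratfun_inv (psi T s)) (- cmx Tcal).
Proof.
move=> Kry T Bk Ck X Tcal Rhat pA s_gt0 _ _ VV colV [_ ricc stabY] diagT.
have TcalE : Tcal = T - Bk *m Bk^T *m Y.
  rewrite /Tcal mulmxBr mulmxBl; congr (_ - _).
  by rewrite /X /Bk trmx_mul trmxK !mulmxA -[_ *m V^T *m V]mulmxA VV mulmx1.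
(* Multiplied by [V^T], the residual becomes the left-hand side of the reduced Riccati equation. *)
have VRhat : V^T *m Rhat = 0.
  rewrite -[RHS]ricc /Rhat TcalE !mulmxDr !mulmxA VV mul1mx mulmxN !mulmxA.
  by rewrite /T /Ck !trmx_mul !trmxK !mulmxA addrA.
set M := cmx A^T; pose W := cmx V^T; pose U := cmx V.
have WU : W *m U = 1%:M by rewrite -cmxM VV [LHS]map_mx1.
pose qp : {poly R[i]} := \prod_(z <- s) ('X - z%:P).
have sM z : z \in s -> M - z%:M \in unitmx.
  move=> /s_gt0 z0; apply: not_eigenvalue_unit; apply/negP.
  by move=> /(passive_stable_trmx pA); rewrite ltNge ltW.
pose b := invmx (horner_mx M qp) *m cmx c.
have qu : horner_mx M qp \in unitmx.
  by have := prod_invmx_mul_horner sM => /mulmx1_unit[].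
have cE : cmx c = horner_mx M qp *m b by rewrite mulKVmx.
have colU j : in_poly_krylov M b k.+1 (col j U).
  have : col j U \in Kry.
    by rewrite -colV; apply/memv_span/map_f; rewrite mem_enum.
  apply: in_poly_krylov_span => w /mapP[m _ ->].
  exact: krylov_vec_in_poly.
pose chi := char_poly (cmx T).
(* The compression of [A^T] is the transpose of [T]. *)
have chiE : char_poly (W *m M *m U) = chi.
  rewrite -char_poly_trmx; congr char_poly.
  by rewrite -!cmxM [LHS]map_trmx !trmx_mul !trmxK mulmxA.
pose S := - cmx Tcal.
have diagS : diagonalizable S by exact: diagonalizable_oppmx.
(* Roots of [chi] have negative real part, eigenvalues of [S = - Tcal] positive real part. *)
have chiS : horner_mx S chi \in unitmx.
  apply: horner_mx_unit => [|z].
    by rewrite monic_neq0 // char_poly_monic.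
  rewrite -eigenvalue_root_char => /(passive_compression_stable pA VV) z0.
  apply/negP => /eigenvalueP[v vS v0].
  have : eigenvalue (cmx Tcal) (- z).
    by apply/eigenvalueP; exists v => //; rewrite scaleNr -vS mulmxN opprK.
  by rewrite TcalE => /stabY; rewrite raddfN /= oppr_lt0 ltNge ltW.
rewrite /ratfun_mx /= -/qp -/chi -/S.
(* Multiplying by [chi(S)] on the right turns the goal into [Rhat chi(S) = chi(M) b c^T V q(S)],
   which is then tested on eigenvectors of [S]. *)
apply: (can_inj (mulmxK chiS)); rewrite !mulmxA mulmxKV //.
rewrite -[X in X *m cmx (c^T *m V)]mulmxA -/b.
apply: (diagonalizable_mx_ext diagS) => x lam Sx.
pose a := (cmx (c^T *m V) *m x) 0 0.
have RhatE : cmx Rhat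
    = M *m U *m cmx Y + U *m cmx Y *m cmx Tcal + cmx c *m cmx (c^T *m V).
  by rewrite -!cmxM -!cmxD mulmxA.
have rE : cmx Rhat *m x
    = M *m (U *m (cmx Y *m x)) - lam *: (U *m (cmx Y *m x))
      + a *: (horner_mx M qp *m b).
  rewrite -cE RhatE !mulmxDl.
  rewrite -!mulmxA; congr (_ + _ + _).
    by rewrite -[cmx Tcal]opprK mulNmx Sx !mulmxN -!scalemxAr.
  by rewrite -mul_mx_scalar -mx11_scalar !mulmxA.
have szq : (size qp <= k.+2)%N by rewrite size_prod_XsubC size_tuple.
have Wr : W *m (cmx Rhat *m x) = 0.
  by rewrite mulmxA -cmxM VRhat [cmx _]map_mx0 mul0mx.
rewrite -!mulmxA (horner_mx_eigenvector _ Sx) -scalemxAr -chiE.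
move: Wr; rewrite rE => /(krylov_residual WU colU szq) ->.
rewrite chiE (horner_mx_eigenvector _ Sx) -!scalemxAr [cmx _ *m x]mx11_scalar.
by rewrite mul_mx_scalar -!scalemxAr scalerA mulrC.
Qed.
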